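(* Let $N$ be a non-negative real number and $k$ a positive integer. The following numbers are equal: \begin{itemize} \item the maximal weight $|A^k|$, where $A$ ranges over all nilpotent square matrices (of arbitrary finite size) with non-negative real entries and weight $|A|=N$; \item the maximal product of $k$ non-negative real numbers with sum $N$; \item $\left(\frac{N}{k}\right)^k$. \end{itemize}
   Context: For a square matrix $A\in M_n(\mathbb{R}_{\ge 0})$ with non-negative real entries, the weight of $A$ is $|A|:=\sum_{i,j=1}^n A_{ij}$, the sum of all of its entries. *)

(* Defs.v *)
From HB Require Import structures.
From mathcomp Require Import all_boot all_order all_algebra.
From mathcomp Require Import classical_sets reals.

Set Implicit Arguments.
Unset Strict Implicit.
Unset Printing Implicit Defensive.

Import Order.TTheory GRing.Theory Num.Theory.

Local Open Scope ring_scope.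
Local Open Scope classical_set_scope.

Definition nilpotent (A : pzRingType) (a : A) : Prop :=
  exists m : nat, a ^+ m = 0.

Definition nonneg_mx (R : realType) (n : nat) (A : 'M[R]_n) : Prop :=
  forall i j, 0 <= A i j.

Definition weight (R : realType) (n : nat) (A : 'M[R]_n) : R :=
  \sum_(i < n) \sum_(j < n) A i j.

(* A maximum is attained, unlike a mere supremum. *)
Definition is_maximum (R : realType) (S : set R) (m : R) : Prop :=
  S m /\ ubound S m.

Definition nilpotent_power_weights (R : realType) (N : R) (k : nat) : set R :=
  [set w | exists (n : nat) (A : 'M[R]_n),
     [/\ nonneg_mx A, nilpotent A, weight A = N & w = weight (A ^+ k)]].

Definition products_with_sum (R : realType) (N : R) (k : nat) : set R :=
  [set p | exists x : 'I_k -> R,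
     [/\ forall i, 0 <= x i, \sum_(i < k) x i = N & p = \prod_(i < k) x i]].

(* Main.v *)
Require Import Defs.
From HB Require Import structures.
From mathcomp Require Import all_boot all_order all_algebra.
From mathcomp Require Import classical_sets reals.

Import Order.TTheory GRing.Theory Num.Theory.
Local Open Scope ring_scope.

(** Read [A] as a weighted digraph: [A i j] is the weight of the edge from [i]
    to [j], and the weight of [A ^+ k] is the sum over all walks with [k] edges
    of the product of their edge weights. A nilpotent non-negative matrix is an
    acyclic digraph, that is, some rank function on the vertices decreases
    along every edge ([nilpotent_decreases]).

    The value (N / k) ^ k is attained by a directed path of [k] edges of weight
    N / k. The upper bound rests on two ideas.

    First, a walk in an acyclic digraph leaves each vertex at most once, so the
    weight of [A ^+ k] is an affine function of each single row of [A]. Hence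
    it is the average, with coefficients proportional to the entries of the
    row, of the values obtained by moving the whole mass of that row onto one
    of its edges ([walk_weight_average]). These moves change neither the total
    weight nor the rank function, so it suffices to treat digraphs in which
    every vertex has at most one outgoing edge: rooted forests.

    Secondly, in a forest every vertex has a depth, the number of edges from it
    to its root, and the edges of a walk with [k] edges start at [k] consecutive
    depths. If [b e] is the total weight of the edges that start
    at depth [e], then the walks from depth [e] contribute at most
    [b e * b (e - 1) * ... * b (e - k + 1)]. Colour the depths modulo [k]: each
    such window meets every colour exactly once, and distinct windows give
    distinct terms in the expansion of the product of the [k] colour totals
    ([sum_windows_le_prod]). These totals are [k] non-negative numbers with sum
    [N], and the inequality between arithmetic and geometric means concludes
    ([prod_le_mean_expr]); the same inequality, attained by [k] equal factors,
    is the statement about products. *)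

(** * Walks and acyclicity *)

Fixpoint walk_weight {R : realType} {n : nat} (A : 'M[R]_n) (l : nat) (i : 'I_n) : R :=
  if l is l'.+1 then \sum_j A i j * walk_weight A l' j else 1.

Lemma row_sum_expr (R : realType) (n : nat) (A : 'M[R]_n) l i :
  \sum_j (A ^+ l) i j = walk_weight A l i.
Proof.
elim: l i => [|l IH] i /=.
  rewrite expr0 (bigD1 i) //= big1 ?addr0 => [|j ji].
    by rewrite mxE eqxx.
  by rewrite mxE eq_sym (negPf ji).
rewrite exprS; under eq_bigr do rewrite mxE.
rewrite exchange_big /=; apply: eq_bigr => j _.
by rewrite -mulr_sumr IH.
Qed.

Lemma weight_expr (R : realType) (n : nat) (A : 'M[R]_n) l :
  weight (A ^+ l) = \sum_i walk_weight A l i.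
Proof. by apply: eq_bigr => i _; rewrite row_sum_expr. Qed.

Lemma walk_weight_ge0 (R : realType) (n : nat) (A : 'M[R]_n) l i :
  nonneg_mx A -> 0 <= walk_weight A l i.
Proof.
move=> A0; elim: l i => [|l IH] i /=; first exact: ler01.
by apply: sumr_ge0 => j _; apply: mulr_ge0.
Qed.

(** Acyclicity is witnessed by a rank function instead of being stated as
    nilpotency, because a rank function visibly survives any change of weights
    that creates no edge. *)
Definition decreases_along {R : realType} {n : nat} (h : 'I_n -> nat) (A : 'M[R]_n) :=
  forall i j, A i j != 0 -> (h j < h i)%N.

(** The rank of [i] is the least [l] for which no walk of [l] edges starts at
    [i]. If [A i j] is positive, the vanishing of the sum that defines the walk
    weight at [i] forces the vanishing, one step earlier, at [j]. *)
Lemma nilpotent_decreases (R : realType) (n : nat) (A : 'M[R]_n) :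
  nonneg_mx A -> nilpotent A -> exists h, decreases_along h A.
Proof.
move=> A0 [m Am].
have ex i : exists l, walk_weight A l i == 0.
  by exists m; rewrite -row_sum_expr Am big1 // => j _; rewrite mxE.
exists (fun i => ex_minn (ex i)) => i j Aij.
case: (ex_minnP (ex j)) => dj _ minj; case: (ex_minnP (ex i)) => [[|l]] /=.
  by rewrite oner_eq0.
rewrite psumr_eq0 => [/allP/(_ j (mem_index_enum _))|]; last first.
  by move=> p _; rewrite mulr_ge0 // walk_weight_ge0.
by rewrite /= mulf_eq0 (negPf Aij) /= => /minj.
Qed.

(** * Concentrating a row on one edge *)

(** Walks only descend in rank, so those that start below rank [m] never see
    the rows of rank [m] or more. *)
Lemma eq_walk_weight_below (R : realType) (n : nat) (h : 'I_n -> nat)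
    (A B : 'M[R]_n) m :
    decreases_along h A -> (forall i j, (h i < m)%N -> A i j = B i j) ->
  forall l i, (h i < m)%N -> walk_weight A l i = walk_weight B l i.
Proof.
move=> hA AB; elim=> [//|l IH] i im /=; apply: eq_bigr => j _.
rewrite -AB //; have [->|/hA ji] := eqVneq (A i j) 0; first by rewrite !mul0r.
by rewrite IH // (ltn_trans ji).
Qed.

Definition move_row {R : realType} {n : nat} (A : 'M[R]_n) (x w : 'I_n) : 'M[R]_n :=
  \matrix_(i, j) if i == x then (\sum_l A x l) *+ (j == w) else A i j.

Lemma weight_move_row (R : realType) (n : nat) (A : 'M[R]_n) x w :
  weight (move_row A x w) = weight A.
Proof.
apply: eq_bigr => i _; under eq_bigr do rewrite mxE.
have [->|//] := eqVneq i x.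
rewrite (bigD1 w) //= eqxx [X in _ + X]big1 ?addr0 // => j /negPf -> //.
Qed.

(** Affinity in the row [x]. At a vertex other than [x], the first step does
    not involve the row [x], and induction applies. At [x] itself, the first
    step is linear in the row, and the rest of the walk stays below the rank of
    [x], where the matrices [A] and [move_row A x w] agree. *)
Lemma walk_weight_average (R : realType) (n : nat) (h : 'I_n -> nat)
    (A : 'M[R]_n) x :
    decreases_along h A -> \sum_j A x j != 0 ->
  forall l i, walk_weight A l i =
    \sum_w (A x w / \sum_j A x j) * walk_weight (move_row A x w) l i.
Proof.
move=> hA r0; elim=> [|l IH] i /=.
  by under eq_bigr do rewrite mulr1; rewrite -mulr_suml divff.
have [->|ix] := eqVneq i x.
  apply: eq_bigr => w _.
  have -> : \sum_j move_row A x w x j * walk_weight (move_row A x w) l j =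
      (\sum_j A x j) * walk_weight (move_row A x w) l w.
    rewrite (bigD1 w) //= [X in _ + X]big1 => [|j /negPf jw].
      by rewrite mxE !eqxx addr0.
    by rewrite mxE eqxx jw mul0r.
  rewrite mulrA divfK //.
  have [->|/hA wx] := eqVneq (A x w) 0; first by rewrite !mul0r.
  congr (_ * _); apply: eq_walk_weight_below hA _ _ _ wx => p j px.
  by rewrite mxE; case: eqP px => // ->; rewrite ltnn.
under eq_bigr do rewrite IH mulr_sumr.
rewrite exchange_big /=; apply: eq_bigr => w _; rewrite mulr_sumr.
by apply: eq_bigr => j _; rewrite mxE (negPf ix) mulrCA.
Qed.

(** * Forests *)

(** Following [s] from [i] lowers the rank as long as [a] is nonzero, so it
    reaches a zero of [a], which is a root of the forest. The number of steps
    drops by exactly one along an edge, whereas the rank [h] may drop by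
    more. *)
Lemma forest_depth (R : realType) (n : nat) (a : 'I_n -> R)
    (s : 'I_n -> 'I_n) (h : 'I_n -> nat) :
    (forall i, a i != 0 -> (h (s i) < h i)%N) ->
  exists d : 'I_n -> nat, forall i, a i != 0 -> d i = (d (s i)).+1.
Proof.
move=> hs.
have ex i : exists l, a (iter l s i) == 0.
  have [m] := ubnP (h i); elim: m i => // m IH i im.
  have [ai|/hs si] := eqVneq (a i) 0; first by exists 0%N; rewrite /= ai.
  have [l al] := IH (s i) (leq_trans si im).
  by exists l.+1; rewrite iterSr.
exists (fun i => ex_minn (ex i)) => i ai.
case: (ex_minnP (ex i)) => [[|l]]; first by rewrite /= (negPf ai).
case: (ex_minnP (ex (s i))) => m am minm; rewrite iterSr => al minl.
by apply/eqP; rewrite eqSS eqn_leq minm // andbT -ltnS minl // iterSr.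
Qed.

(** [T t] is the sum of the [b e] with [e <= m] and [e] congruent to [m - t]
    modulo [k.+1]. Indexing the colours by their distance to the current [m]
    makes a step from [m] to [m.+1] a rotation of [T], with [b m.+1] added to
    one coordinate, so that no residue has to be computed. The product of the
    new totals is the old product plus [b m.+1] times the product of the
    other totals, and these dominate the other entries of the new window.
    The windows are completed below 0 by truncated subtraction; they then
    contain the factor [b 0 = 0]. *)
Lemma sum_windows_le_prod (R : realType) (b : nat -> R) (k m : nat) :
    (forall e, 0 <= b e) -> b 0 = 0 ->
  exists T : nat -> R,
    [/\ forall t, b (m - t)%N <= T t,
        \sum_(t < k.+1) T t = \sum_(e < m.+1) b e
      & \sum_(e < m.+1) \prod_(t < k.+1) b (e - t)%N <= \prod_(t < k.+1) T t].
Proof.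
move=> b0 b00; elim: m => [|m [T [bT sumT winT]]].
  exists (fun=> 0); split=> [t||].
  - by rewrite sub0n b00.
  - by rewrite big1 // big_ord1 b00.
  - by rewrite big_ord1 !big_ord_recl /= b00 !mul0r.
exists (fun t => if t is t'.+1 then T t' else T k + b m.+1).
split=> [[|t]||].
- by rewrite subn0 lerDr (le_trans _ (bT k)).
- by rewrite subSS.
- rewrite big_ord_recl big_ord_recr -sumT big_ord_recr /=.
  by rewrite [LHS]addrC addrA.
- rewrite big_ord_recr [leRHS]big_ord_recl /= mulrDl.
  apply: lerD; first by rewrite mulrC; move: winT; rewrite [leRHS]big_ord_recr.
  rewrite big_ord_recl subn0; apply: ler_wpM2l => //.
  by apply: ler_prod => t _; rewrite b0 subSS bT.
Qed.

Lemma prod_le_mean_expr (R : realType) (k : nat) (x : 'I_k -> R) :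
  (forall i, 0 <= x i) -> \prod_i x i <= ((\sum_i x i) / k%:R) ^+ k.
Proof.
move=> x0; have := @leif_AGM R 'I_k predT x (fun i _ => x0 i).
by rewrite /= card_ord => /leifP/=; case: ifP => _ => [/eqP ->|/ltW].
Qed.

(** Here [s i] is the only possible head of an edge that leaves [i]. *)
Lemma weight_expr_le_forest (R : realType) (n : nat) (h : 'I_n -> nat)
    (A : 'M[R]_n) (s : 'I_n -> 'I_n) (k : nat) :
    nonneg_mx A -> decreases_along h A ->
    (forall i j, j != s i -> A i j = 0) -> (0 < k)%N ->
  weight (A ^+ k) <= (weight A / k%:R) ^+ k.
Proof.
move=> A0 hA As; case: k => // k _.
pose a i := A i (s i).
have rowE i (F : 'I_n -> R) : \sum_j A i j * F j = a i * F (s i).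
  by rewrite (bigD1 (s i)) //= big1 ?addr0 // => j /As ->; rewrite mul0r.
have a0 i : 0 <= a i by exact: A0.
have [d dE] := @forest_depth R n a s h (fun i => hA i (s i)).
pose b e := \sum_(i | d i == e) a i.
have b_ge0 e : 0 <= b e by exact: sumr_ge0.
(* An edge that leaves [i] forces the depth of [i] to be a successor. *)
have b00 : b 0%N = 0.
  by rewrite /b big1 // => i /eqP di; apply: contra_eq di => /dE ->.
have walk0 l i : 0 <= walk_weight A l i by exact: walk_weight_ge0.
(* The walks that start at depth [e] are bounded by all ways of choosing
   independently one edge at each of the depths [e], [e - 1], and so on. *)
have level e l : \sum_(i | d i == e) walk_weight A l.+1 i <=
    \prod_(t < l.+1) b (e - t)%N.
  elim: l e => [|l IH] e.
    by rewrite big_ord1 subn0 ler_sum // => i _ /=; rewrite rowE mulr1.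
  rewrite big_ord_recl subn0 mulr_suml; apply: ler_sum => i /eqP di.
  rewrite [walk_weight _ _ _]rowE.
  have [->|/dE dsi] := eqVneq (a i) 0; first by rewrite !mul0r.
  apply: ler_wpM2l => //; move: dsi; rewrite di => ->.
  apply: le_trans (IH (d (s i))).
  rewrite [leRHS](bigD1 (s i)) //= lerDl.
  by apply: sumr_ge0 => j _; exact: (walk0 l.+1).
pose D := \max_i d i.
have by_level (F : 'I_n -> R) :
    \sum_i F i = \sum_(e < D.+1) \sum_(i | d i == e) F i.
  rewrite (partition_big (fun i => inord (d i) : 'I_D.+1) xpredT) //=.
  apply: eq_bigr => e _; apply: eq_bigl => i.
  by rewrite -val_eqE /= inordK // ltnS (leq_bigmax i).
have [T [bT sumT winT]] := @sum_windows_le_prod R b k D b_ge0 b00.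
have -> : weight A = \sum_(t < k.+1) T t.
  rewrite sumT -by_level; apply: eq_bigr => i _.
  by rewrite -[RHS]mulr1 -(rowE i (fun=> 1)); apply: eq_bigr => j _; rewrite mulr1.
rewrite weight_expr by_level.
apply: (le_trans (y := \prod_(t < k.+1) T t)); last first.
  by apply: prod_le_mean_expr => t; exact: le_trans (bT t).
by apply: le_trans winT; apply: ler_sum.
Qed.

(** The rows are concentrated one after the other. An average of quantities,
    each at most the bound, is at most the bound, so no choice of a best edge
    is needed. Only edges that are already present receive weight, which
    preserves the rank function. *)
Lemma weight_expr_le_acyclic (R : realType) (n : nat) (h : 'I_n -> nat)
    (A : 'M[R]_n) (k : nat) :
    nonneg_mx A -> decreases_along h A -> (0 < k)%N ->
  weight (A ^+ k) <= (weight A / k%:R) ^+ k.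
Proof.
move=> A0 hA k0.
pose concentrated (B : 'M[R]_n) i := exists w, forall j, j != w -> B i j = 0.
have : forall i, i \notin enum 'I_n -> concentrated A i.
  by move=> i; rewrite mem_enum.
elim: (enum 'I_n) A A0 hA => [|x r IH] A A0 hA conc.
  have [s As] := fin_all_exists (fun i => conc i isT).
  exact: (@weight_expr_le_forest _ _ h A s).
have [r0|r0] := eqVneq (\sum_j A x j) 0.
  apply: IH => // i ir; have [->|ix] := eqVneq i x; last first.
    by apply: conc; rewrite inE negb_or ix.
  exists x => j _; apply/eqP; move/eqP: r0; rewrite psumr_eq0 //.
  by move=> /allP/(_ j (mem_index_enum _)).
rewrite weight_expr.
under eq_bigr do rewrite (walk_weight_average _ _ _ _ x hA) //.
rewrite exchange_big /=; under eq_bigr do rewrite -mulr_sumr -weight_expr.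
(* The coefficients [A x w / \sum_j A x j] of the average add up to 1. *)
set M := leRHS; rewrite -[M]mul1r -{1}(divff r0) !mulr_suml; apply: ler_sum => w _.
have [->|Axw] := eqVneq (A x w) 0; first by rewrite !mul0r.
apply: ler_wpM2l; first by rewrite divr_ge0 ?sumr_ge0.
rewrite /M -(weight_move_row _ _ A x w); apply: IH => [i j|i j|i ir].
- by rewrite mxE; case: ifP => // _; rewrite mulrn_wge0 // sumr_ge0.
- rewrite mxE; have [->|_] := eqVneq i x; last exact: hA.
  by have [-> _|_] := eqVneq j w; [exact: hA|rewrite eqxx].
- have [->|ix] := eqVneq i x.
    by exists w => j /negPf jw; rewrite mxE eqxx jw.
  have [|v Av] := conc i; first by rewrite inE negb_or ix.
  by exists v => j /Av; rewrite mxE (negPf ix).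
Qed.

(** * The extremal path *)

(** For [m = 1], the path 0 -> 1 -> ... -> k with all edges of weight [c]; its
    [m]-th power is again of this shape, with shift [m] and weight
    [c ^+ m]. *)
Definition shift_mx (R : realType) (k : nat) (c : R) (m : nat) : 'M[R]_k.+1 :=
  \matrix_(i, j) (c *+ (j == i + m :> nat)%N).

Lemma shift_mx_expr (R : realType) (k : nat) (c : R) m :
  shift_mx R k c 1 ^+ m = shift_mx R k (c ^+ m) m.
Proof.
elim: m => [|m IH].
  by rewrite !expr0; apply/matrixP => i j; rewrite !mxE addn0 -val_eqE eq_sym.
rewrite exprS IH; apply/matrixP => i j; rewrite !mxE.
under eq_bigr do rewrite !mxE.
have [ik|ik] := ltnP (i + 1) k.+1.
  rewrite (bigD1 (Ordinal ik)) //= big1 => [|l li].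
    by rewrite eqxx addr0 exprS mulr1n mulrnAr -addnA add1n.
  have /negPf -> : (l != i + 1 :> nat)%N := li.
  by rewrite mul0r.
rewrite big1 => [|l _]; last by rewrite ltn_eqF ?mul0r // (leq_trans _ ik).
by rewrite ltn_eqF // (leq_trans (ltn_ord j)) // (leq_trans ik) // leq_add2l.
Qed.

Lemma weight_shift_mx (R : realType) (k : nat) (c : R) m :
  weight (shift_mx R k c m) = c *+ (k.+1 - m).
Proof.
have -> : weight (shift_mx R k c m) =
    \sum_(i < k.+1) if (i < k.+1 - m)%N then c else 0.
  apply: eq_bigr => i _; under eq_bigr do rewrite mxE.
  rewrite ltn_subRL addnC; case: ltnP => im.
    rewrite (bigD1 (Ordinal im)) //= eqxx big1 ?addr0 // => j.
    by rewrite -val_eqE /= => /negPf ->.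
  by rewrite big1 // => j _; rewrite ltn_eqF // (leq_trans _ im).
rewrite -big_mkcond /= -(big_ord_widen _ (fun=> c)) ?leq_subr //.
by rewrite sumr_const card_ord.
Qed.

Theorem theorem0p6 (R : realType) (N : R) (k : nat) (hN : 0 <= N) (hk : (0 < k)%N) :
  exists M : R,
    [/\ is_maximum (nilpotent_power_weights N k) M,
        is_maximum (products_with_sum N k) M
      & M = (N / k%:R) ^+ k].
Proof.
have c0 : 0 <= N / k%:R by rewrite divr_ge0.
have kc : (N / k%:R) *+ k = N by rewrite -mulr_natr divfK // pnatr_eq0 -lt0n.
exists ((N / k%:R) ^+ k); split=> //; split.
- exists k.+1, (shift_mx R k (N / k%:R) 1); split.
  + by move=> i j; rewrite mxE mulrn_wge0.
  + exists k.+1; rewrite shift_mx_expr; apply/matrixP => i j; rewrite !mxE.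
    by rewrite ltn_eqF // (leq_trans (ltn_ord j)) // leq_addl.
  + by rewrite weight_shift_mx subn1.
  + by rewrite shift_mx_expr weight_shift_mx subSnn.
- move=> _ [n [A [A0 Anil <- ->]]].
  have [h hA] := nilpotent_decreases _ _ _ A0 Anil.
  exact: weight_expr_le_acyclic hA _.
- exists (fun=> N / k%:R); split=> //.
    by rewrite sumr_const card_ord.
  by rewrite prodr_const card_ord.
- by move=> _ [x [x0 <- ->]]; exact: prod_le_mean_expr.
Qed.
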